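(* Consider a multi-agent system with $n$ agents and let $(\pi,\pi')$ be two consecutive joint policies of all agents, with $\pi_{-i}$ and $\pi_{-i}'$ the corresponding joint policies of all agents other than $i$. Then the average opponent switching cost is bounded above by the maximum KL-divergence of the joint policies: $$\frac1n\sum_{i=1}^n d^i_{\rm switch}(\pi_{-i},\pi_{-i}')\ \le\ \max_{(t,\boldsymbol o)\in[T]\times\mathcal O}D_{\rm KL}\big(\pi^t(\cdot\mid\boldsymbol o)\,\|\,[\pi']^t(\cdot\mid\boldsymbol o)\big).$$
   Context: Agents $1,\dots,n$ have finite action sets $\mathcal A_i$; $\mathcal O$ is the finite joint observation space; $[T]=\{1,\dots,T\}$, $T\ge1$. A (time-indexed) joint policy $\pi$ gives, for each $t\in[T]$ and $\boldsymbol o\in\mathcal O$, a probability distribution $\pi^t(\cdot\mid\boldsymbol o)$ over joint actions $\boldsymbol a=(a_1,\dots,a_n)\in\mathcal A_1\times\cdots\times\mathcal A_n$. For agent $i$, $\pi_{-i}^t(\cdot\mid\boldsymbol o)$ is the marginal of $\pi^t(\cdot\mid\boldsymbol o)$ on $a_{-i}=(a_j)_{j\ne i}$ (the opponents' joint policy), and similarly for $\pi'$. Opponent switching cost of agent $i$: $d^i_{\rm switch}(\pi_{-i},\pi_{-i}')=\max_{(t,\boldsymbol o)\in[T]\times\mathcal O}D_{\rm KL}\big(\pi_{-i}^t(\cdot\mid\boldsymbol o)\,\|\,[\pi_{-i}']^t(\cdot\mid\boldsymbol o)\big)$, where $D_{\rm KL}$ is the Kullback–Leibler divergence (with value in $[0,+\infty]$).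 *)

(* Defs.v *)
From HB Require Import structures.
From mathcomp Require Import all_boot all_order all_algebra.
From mathcomp Require Import all_classical all_reals all_analysis.

Set Implicit Arguments.
Unset Strict Implicit.
Unset Printing Implicit Defensive.

Import Order.TTheory GRing.Theory Num.Theory.
Local Open Scope ring_scope.

Record fdist (R : realType) (B : finType) := FDist {
  pmf :> B -> R;
  pmf_ge0 : forall b, 0 <= pmf b;
  pmf_sum1 : \sum_(b : B) pmf b = 1 }.

Section Pushforward.
Variables (R : realType) (B C : finType) (f : B -> C) (p : fdist R B).

Definition push_pmf (c : C) : R := \sum_(b : B | f b == c) p b.

Lemma push_pmf_ge0 c : 0 <= push_pmf c.
Proof. by apply: sumr_ge0 => b _; exact: pmf_ge0. Qed.

Lemma push_pmf_sum1 : \sum_(c : C) push_pmf c = 1.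
Proof. by rewrite -(pmf_sum1 p) (partition_big f xpredT). Qed.

Definition fdist_push : fdist R C := FDist push_pmf_ge0 push_pmf_sum1.

End Pushforward.

(* Natural logarithm.  If p b = 0 the summand is 0, whatever the value of
   [ln (p b / q b)], which is the convention 0 * log (0 / q) = 0; the junk
   value of [_ / 0] is only reached in that case. *)
Definition KL (R : realType) (B : finType) (p q : fdist R B) : \bar R :=
  if [forall b : B, (q b == 0) ==> (p b == 0)]
  then (\sum_(b : B) p b * ln (p b / q b))%:E
  else +oo%E.

(* ['I_T] stands for {1, ..., T} and ['I_n] for the agents 1, ..., n. *)
Definition policy (R : realType) (T : nat) (O B : finType) : Type :=
  'I_T -> O -> fdist R B.

Definition joint_action (n : nat) (A : 'I_n -> finType) : finType :=
  {dffun forall j : 'I_n, A j}.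

Definition opp_action (n : nat) (A : 'I_n -> finType) (i : 'I_n) : finType :=
  {dffun forall j : {j : 'I_n | j != i}, A (val j)}.

Definition drop_agent (n : nat) (A : 'I_n -> finType) (i : 'I_n)
    (a : joint_action A) : opp_action A i :=
  [ffun j : {j : 'I_n | j != i} => a (val j)].

Definition opp_policy (R : realType) (n : nat) (A : 'I_n -> finType) (T : nat)
    (O : finType) (i : 'I_n) (pi : policy R T O (joint_action A)) :
    policy R T O (opp_action A i) :=
  fun t o => fdist_push (drop_agent i) (pi t o).

(* The neutral element -oo only matters when the family is empty, i.e. when
   [T = 0] or [O] is empty; otherwise this is a genuine maximum. *)
Definition d_switch (R : realType) (n : nat) (A : 'I_n -> finType) (T : nat)
    (O : finType) (i : 'I_n) (mu mu' : policy R T O (opp_action A i)) :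
    \bar R :=
  \big[maxe/-oo%E]_(x : 'I_T * O) KL (mu x.1 x.2) (mu' x.1 x.2).

(* Main.v *)
(* Dropping agent i pushes a joint policy forward along a map f of finite sets,
   and the data-processing inequality says that a pushforward does not increase
   the KL divergence.  Each opponent switching cost is thus at most the joint
   maximum, and so is their average.  With P, Q the pushforwards of p, q, data
   processing follows by summing over b the consequence of ln x <= x - 1
     p b ln (p b / q b) - p b ln (P (f b) / Q (f b))
       >= p b - q b * P (f b) / Q (f b),
   whose right-hand side has a nonnegative sum. *)
Require Import Defs.
From HB Require Import structures.
From mathcomp Require Import all_boot all_order all_algebra.
From mathcomp Require Import all_classical all_reals all_analysis.
From mathcomp Require Import ring lra.

Set Implicit Arguments.
Unset Strict Implicit.
Unset Printing Implicit Defensive.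

Import Order.TTheory GRing.Theory Num.Theory.
Local Open Scope ring_scope.
Local Open Scope ereal_scope.

Lemma push_pmf_gt0 (R : realType) (B C : finType) (f : B -> C) (p : fdist R B)
    (b : B) : (0 < p b -> 0 < push_pmf f p (f b))%R.
Proof.
move=> pb0; rewrite /push_pmf (bigD1 b) //=.
by apply: ltr_pwDl => //; apply: sumr_ge0 => x _; exact: Defs.pmf_ge0.
Qed.

Lemma push_pmf_eq0 (R : realType) (B C : finType) (f : B -> C) (p q : fdist R B)
    (c : C) : (forall b, q b = 0 -> p b = 0)%R ->
  (push_pmf f q c = 0 -> push_pmf f p c = 0)%R.
Proof.
move=> pq /eqP; rewrite /push_pmf psumr_eq0;
  last by move=> b _; exact: Defs.pmf_ge0.
move=> /allP q0; apply: big1 => b fbc; apply: pq; apply/eqP.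
by have := q0 b; rewrite mem_index_enum fbc => /(_ isT).
Qed.

(** If [p > 0], all four numbers are positive and this is [p] times [ln x <= x - 1] at
    [x = (P / Q) / (p / q)]. If [p = 0], the right side vanishes and the left is nonpositive. *)
Lemma mul_ln_div_ge (R : realType) (p q P Q : R) : (0 <= p -> 0 <= q ->
  0 <= P -> 0 <= Q -> (q = 0 -> p = 0) -> (0 < p -> 0 < P) ->
  (0 < q -> 0 < Q) ->
  p - q * (P / Q) <= p * ln (p / q) - p * ln (P / Q))%R.
Proof.
move=> p0 q0 P0 Q0 qp pP qQ; have [->|pn0] := eqVneq p 0%R.
  by rewrite !mul0r subrr sub0r oppr_le0 mulr_ge0 // divr_ge0.
have pgt : (0 < p)%R by rewrite lt_def pn0.
have qgt : (0 < q)%R.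
  by rewrite lt_def q0 andbT; apply: contra_neq pn0 => /qp.
have Pgt := pP pgt; have Qgt := qQ qgt.
have pq0 : (0 < p / q)%R by rewrite divr_gt0.
have PQ0 : (0 < P / Q)%R by rewrite divr_gt0.
have -> : (p - q * (P / Q) = p * (1 - (P / Q) / (p / q)))%R.
  by field; rewrite !gt_eqF.
rewrite -mulrBr ler_pM2l //.
have := le_ln1Dx (x := ((P / Q) / (p / q) - 1)%R).
rewrite [(1 + _)%R]addrC subrK ln_div ?posrE // => h.
suff : (ln (P / Q) - ln (p / q) <= (P / Q) / (p / q) - 1 :> R)%R by lra.
by apply: h; have : (0 < P / Q / (p / q))%R by [exact: divr_gt0]; lra.
Qed.

Lemma KL_push_le (R : realType) (B C : finType) (f : B -> C)
    (p q : fdist R B) :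
  KL (fdist_push f p) (fdist_push f q) <= KL p q.
Proof.
rewrite {2}/KL; case: ifPn => [/forallP ac|_]; last exact: leey.
have {}ac b : (q b = 0 -> p b = 0)%R.
  by move=> /eqP qb; apply/eqP; move/implyP: (ac b); apply.
(* Absolute continuity passes to the pushforwards, so the left side is finite too. *)
rewrite /KL ifT; last first.
  by apply/forallP => c; apply/implyP => /eqP /(push_pmf_eq0 ac) /= ->.
rewrite lee_fin /= -subr_ge0.
pose r c := (push_pmf f p c / push_pmf f q c)%R.
(* The ratio [r] is constant on each fibre of [f], so both divergences become sums over [b]. *)
have -> : (\sum_c push_pmf f p c * ln (r c) = \sum_b p b * ln (r (f b)))%R.
  rewrite [RHS](partition_big f xpredT) //=; apply: eq_bigr => c _.
  by rewrite mulr_suml; apply: eq_bigr => b /eqP ->.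
rewrite -sumrB.
apply: (@le_trans _ _ (\sum_b (p b - q b * r (f b)))%R); last first.
  by apply: ler_sum => b _; apply: mul_ln_div_ge;
    rewrite ?Defs.pmf_ge0 ?push_pmf_ge0 //; [exact: ac|exact: push_pmf_gt0..].
rewrite sumrB pmf_sum1 subr_ge0.
rewrite (partition_big f xpredT) //= -(push_pmf_sum1 f p).
apply: ler_sum => c _.
rewrite (eq_bigr (fun b => q b * r c)%R) => [|b /eqP -> //].
rewrite -mulr_suml -/(push_pmf f q c) /r mulrC.
(* The fibre over [c] contributes exactly [push_pmf f p c], or 0 when [push_pmf f q c = 0]. *)
have [->|q0] := eqVneq (push_pmf f q c) 0%R; last by rewrite divfK.
by rewrite mulr0 push_pmf_ge0.
Qed.

Theorem theorem2 (R : realType) (n : nat) (hn : (0 < n)%N)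
    (A : 'I_n -> finType) (T : nat) (hT : (0 < T)%N) (O : finType)
    (pi pi' : policy R T O (joint_action A)) :
  (n%:R^-1)%:E * \sum_(i < n) d_switch (opp_policy i pi) (opp_policy i pi')
  <= \big[maxe/-oo]_(x : 'I_T * O) KL (pi x.1 x.2) (pi' x.1 x.2).
Proof.
set M := (X in _ <= X).
have dM i : d_switch (opp_policy i pi) (opp_policy i pi') <= M.
  by apply: le_bigmax2 => x _; exact: KL_push_le.
(* As an average of [n] copies of itself, [M] can be compared termwise; this also holds for infinite
   [M]. *)
have -> : M = (n%:R^-1)%:E * \sum_(i < n) M.
  rewrite big_const_ord -Monoid.iteropE -[iterop _ _ _ _]mule_natl muleA.
  rewrite -EFinM mulVf ?mul1e //.
  by rewrite pnatr_eq0 -lt0n.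
by rewrite lee_pmul2l // ?lte_fin ?invr_gt0 ?ltr0n //; exact: lee_sum.
Qed.
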